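(* Assume there is a constant $C>0$ such that $p_n-p_{n-1}<C\ln^2 p_{n-1}$ for every pair of consecutive primes $p_{n-1}<p_n$ (Cramér's conjecture). Then for every real $\epsilon$ with $0<\epsilon\le1$ there exists a constant $C(\epsilon)$ such that for every integer $n>C(\epsilon)$ there is a prime $p$ with $(n-1)^{1+\epsilon}<p<n^{1+\epsilon}$.
   Context: $p_1=2,p_2=3,\dots$ denotes the sequence of primes in increasing order. *)

(* Defs.v *)
From mathcomp Require Import all_boot.

Set Implicit Arguments.
Unset Strict Implicit.
Unset Printing Implicit Defensive.

Lemma ex_prime_above (m : nat) : exists p, (m < p) && prime p.
Proof. by have [p lt_mp pr_p] := prime_above m; exists p; rewrite lt_mp. Qed.

Definition next_prime (m : nat) : nat := ex_minn (ex_prime_above m).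

(* Indexed from 1 (nth_prime 1 = 2, nth_prime 2 = 3, ...); the value
   nth_prime 0 = 0 is only the seed of the iteration and is not a prime. *)
Definition nth_prime (n : nat) : nat := iter n next_prime 0.

(* Main.v *)
Require Import Defs.
From mathcomp Require Import all_boot all_order all_algebra.
From mathcomp Require Import reals exp.
From mathcomp Require Import ring lra zify.
Import Order.TTheory GRing.Theory Num.Theory.
Local Open Scope ring_scope.

(** With m = n - 1 and x = m^(1+eps), the first prime p above x exceeds x by
    less than C ln^2 x = C (1+eps)^2 ln^2 m, while
    n^(1+eps) >= (m+1) m^eps = x + m^eps, and m^eps eventually dominates any
    multiple of ln^2 m. *)

Lemma next_primeP (m : nat) : (m < next_prime m)%N && prime (next_prime m).
Proof. by rewrite /next_prime; case: ex_minnP. Qed.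

Lemma prime_nth_prime (k : nat) : prime (nth_prime k.+1).
Proof. by have /andP[] := next_primeP (nth_prime k). Qed.

Lemma leq_nth_prime (k : nat) : (k <= nth_prime k)%N.
Proof.
elim: k => [//|k IHk]; apply: leq_ltn_trans IHk _.
by have /andP[] := next_primeP (nth_prime k).
Qed.

Lemma nth_prime1 : nth_prime 1 = 2%N.
Proof.
rewrite /nth_prime /= /next_prime; case: ex_minnP => p /andP[_ /prime_gt1 p_gt1].
by move=> /(_ 2%N isT) p_le2; apply/eqP; rewrite eqn_leq p_le2.
Qed.

(** Take the least [k] with [x < nth_prime k]; minimality puts the preceding term at or below
    [x]. *)
Lemma consecutive_primes_around (R : realType) (x : R) : 2 <= x ->
  exists k : nat, (2 <= k)%N /\
    (nth_prime k.-1)%:R <= x /\ x < (nth_prime k)%:R.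
Proof.
move=> x_ge2.
have ex_k : exists k, x < (nth_prime k)%:R.
  exists (Num.bound x); apply: (@lt_le_trans _ _ (Num.bound x)%:R).
    by apply: archi_boundP; lra.
  by rewrite ler_nat leq_nth_prime.
case: (ex_minnP ex_k) => k x_lt k_min; exists k.
(* The seed 0 and the first prime 2 are both at most [x], so the preceding term is a genuine
   prime. *)
have k_ge2 : (2 <= k)%N.
  by move: x_lt; case: k {k_min} => [|[|//]]; rewrite ?nth_prime1 /=; lra.
split=> //; split=> //; rewrite leNgt; apply/negP => /k_min; lia.
Qed.

(** Apply [ln y <= y - 1] to [y = x ^ (a / 4)], where [ln x = (4 / a) ln y], and square. *)
Lemma ln_sqr_le_powR (R : realType) (a x : R) : 0 < a -> 1 <= x ->
  ln x ^+ 2 <= (4 / a) ^+ 2 * x `^ (a / 2).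
Proof.
move=> a_gt0 x_ge1.
have y_gt0 : 0 < x `^ (a / 4) by apply: powR_gt0; lra.
have -> : x `^ (a / 2) = (x `^ (a / 4)) ^+ 2.
  by rewrite expr2 -powRD; [congr (_ `^ _); field | apply/implyP; lra].
rewrite -exprMn lerXn2r ?nnegrE ?ln_ge0 //.
  by rewrite mulr_ge0 ?divr_ge0 ?powR_ge0 //; lra.
have -> : ln x = 4 / a * ln (x `^ (a / 4)).
  by rewrite ln_powR; field; rewrite gt_eqF.
rewrite ler_wpM2l ?divr_ge0 //; first lra.
by have := le_ln1Dx (x := x `^ (a / 4) - 1); rewrite (addrC 1) subrK; lra.
Qed.

(** Split [x ^ a] into two factors [x ^ (a / 2)]: one absorbs the squared logarithm, the other the
    constant [B]. *)
Lemma ln_sqr_dominated (R : realType) (A a : R) : 0 < A -> 0 < a ->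
  exists M : R, 1 <= M /\ forall x, M < x -> A * ln x ^+ 2 <= x `^ a.
Proof.
move=> A_gt0 a_gt0; set B := A * (4 / a) ^+ 2.
have B_ge0 : 0 <= B by rewrite mulr_ge0 ?sqr_ge0 // ltW.
(* From [B ^ (2 / a)] on, [x ^ (a / 2)] is at least [B]; the added 1 ensures [x >= 1]. *)
exists (1 + B `^ (2 / a)); split; first by have := powR_ge0 B (2 / a); lra.
move=> x x_gt; have x_ge1 : 1 <= x by have := powR_ge0 B (2 / a); lra.
apply: (@le_trans _ _ (B * x `^ (a / 2))).
  by rewrite -mulrA ler_wpM2l ?(ltW A_gt0) ?ln_sqr_le_powR.
have -> : x `^ a = x `^ (a / 2) * x `^ (a / 2).
  by rewrite -powRD; [congr (_ `^ _); field | apply/implyP; lra].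
rewrite ler_wpM2r ?powR_ge0 //.
have -> : B = (B `^ (2 / a)) `^ (a / 2).
  rewrite -powRrM; have -> : 2 / a * (a / 2) = 1 by field; rewrite gt_eqF.
  by rewrite powRr1.
by rewrite ge0_ler_powR ?nnegrE ?powR_ge0 ?divr_ge0 //; lra.
Qed.

(** The left side is [(x + 1) x ^ a], and [x ^ a <= (x + 1) ^ a]. *)
Lemma powR1D_succ_ge (R : realType) (a x : R) : 0 <= a -> 0 < x ->
  x `^ (1 + a) + x `^ a <= (x + 1) `^ (1 + a).
Proof.
move=> a_ge0 x_gt0.
have split1 y : 0 < y -> y `^ (1 + a) = y * y `^ a.
  by move=> y_gt0; rewrite powRD ?powRr1 ?(ltW y_gt0) // (gt_eqF y_gt0) implybT.
rewrite !split1 //; last lra.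
rewrite -{2}[x `^ a]mul1r -mulrDl ler_wpM2l ?ge0_ler_powR ?nnegrE //; lra.
Qed.

Theorem theorem27 (R : realType) :
  (exists C : R, 0 < C /\
     forall n : nat, (2 <= n)%N ->
       (nth_prime n)%:R - (nth_prime n.-1)%:R
         < C * (ln ((nth_prime n.-1)%:R : R)) ^+ 2) ->
  forall eps : R, 0 < eps -> eps <= 1 ->
  exists Ceps : R, forall n : int, Ceps < n%:~R ->
  exists p : nat, prime p /\
    ((n - 1)%:~R : R) `^ (1 + eps) < p%:R /\
    p%:R < (n%:~R : R) `^ (1 + eps).
Proof.
move=> [C [C_gt0 gap]] eps eps_gt0 _.
have A_gt0 : 0 < C * (1 + eps) ^+ 2 by rewrite mulr_gt0 ?exprn_gt0 //; lra.
have [M [M_ge1 dom]] := @ln_sqr_dominated R _ _ A_gt0 eps_gt0.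
(* This gives [m > M + 1 >= 2], so that [dom] applies to [m] and [m ^ (1 + eps) >= m >= 2]. *)
exists (M + 2) => n n_gt.
set m : R := (n - 1)%:~R.
have nE : n%:~R = m + 1 by rewrite /m intrB subrK.
rewrite nE; have m_gt : M + 1 < m by lra.
have x_ge2 : 2 <= m `^ (1 + eps).
  apply: (@le_trans _ _ (m `^ 1)); first by rewrite powRr1; lra.
  by rewrite ler_powR; lra.
have [k [k_ge2 [q_le p_gt]]] := consecutive_primes_around _ _ x_ge2.
exists (nth_prime k); split.
  by move: k_ge2; case: (k) => // j _; exact: prime_nth_prime.
split=> //.
have q_ge1 : 1 <= (nth_prime k.-1)%:R :> R.
  by rewrite ler1n; apply: leq_trans (leq_nth_prime _); lia.
(* The lower prime is at most [m ^ (1 + eps)], so its logarithm is at most [(1 + eps) ln m]; hence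
   the factor [(1 + eps) ^ 2] in the constant given to [dom]. *)
have ln_le : C * ln (nth_prime k.-1)%:R ^+ 2 <= m `^ eps.
  apply: le_trans (dom m _); last lra.
  rewrite -mulrA -exprMn ler_wpM2l ?(ltW C_gt0) // -ln_powR.
  have ln_mono : ln (nth_prime k.-1)%:R <= ln (m `^ (1 + eps)).
    by rewrite ler_ln // posrE; lra.
  by rewrite lerXn2r ?nnegrE //; have := ln_ge0 q_ge1; lra.
(* With [q] the lower prime and [p] the upper: [p < q + C ln^2 q <= m ^ (1 + eps) + m ^ eps <= (m +
   1) ^ (1 + eps)]. *)
have := @powR1D_succ_ge R eps m (ltW eps_gt0) _; have := gap k k_ge2; lra.
Qed.
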